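(* There is a universal constant $c_0>0$ such that the following holds. Let $T\subset\mathbb{R}^p$ be a closed convex cone. Consider the linear inverse model $Y=\mathcal{X}(M)+Z$ with linear operator $\mathcal{X}:\mathbb{R}^p\to\mathbb{R}^n$ and noise $Z\sim N(0,\frac{\sigma^2}{n}I_n)$. Then the minimax risk restricted to the cone $T$ satisfies $$\inf_{\hat M}\sup_{M\in T}\mathbb{E}_{\cdot|\mathcal{X}}\|\hat M-M\|_{\ell_2}^2\ge\frac{c_0\sigma^2}{\psi^2}\cdot\left(\frac{e(B_2^p\cap T)}{\sqrt n}\vee\frac{v(B_2^p\cap T)}{\sqrt n}\right)^2,$$ where the infimum is over all measurable estimators $\hat M$, $\psi=\sup_{v\in B_2^p\cap T}\|\mathcal{X}(v)\|_{\ell_2}$, and $\mathbb{E}_{\cdot|\mathcal{X}}$ denotes expectation conditional on the design $\mathcal{X}$.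
   Context: $B_2^p$ is the closed Euclidean unit ball of $\mathbb{R}^p$; $a\vee b=\max(a,b)$. Sudakov estimate: $e(K)=\sup_{\epsilon>0}\epsilon\sqrt{\log\mathcal{N}(K,\epsilon)}$, where $\mathcal{N}(K,\epsilon)$ is the smallest cardinality of a set $S\subset K$ such that every $x\in K$ has some $y\in S$ with $\|x-y\|_{\ell_2}<\epsilon$. Volume ratio: $v(K)=\sqrt p\left(\mathrm{vol}(K)/\mathrm{vol}(B_2^p)\right)^{1/p}$. Estimators are measurable functions of $(\mathcal{X},Y)$. *)

(* Defs.v *)
From HB Require Import structures.
From mathcomp Require Import all_boot all_order all_algebra finmap.
From mathcomp Require Import all_classical all_reals all_analysis.
Import Order.TTheory GRing.Theory Num.Theory.
Import numFieldTopology.Exports numFieldNormedType.Exports.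

Set Implicit Arguments.
Unset Strict Implicit.
Unset Printing Implicit Defensive.

Local Open Scope classical_set_scope.
Local Open Scope ring_scope.

Definition measure_matrix_display : measure_display -> measure_display.
Proof. exact. Qed.

(* Matrices carry the product sigma-algebra, generated by the entries; over the
   reals this is the Borel sigma-algebra of R^(m x n). *)
Section measurable_matrix.
Context {d} {T : measurableType d} (m n : nat).

Definition mx_cylinders : set (set 'M[T]_(m, n)) :=
  \bigcup_(ij in [set: 'I_m * 'I_n])
    preimage_set_system setT (fun A : 'M[T]_(m, n) => A ij.1 ij.2) measurable.

HB.instance Definition _ := @isMeasurable.Build (measure_matrix_display d)
  'M[T]_(m, n) <<s mx_cylinders >> (@sigma_algebra0 _ setT mx_cylinders)
  (@sigma_algebraC _ mx_cylinders) (@sigma_algebra_bigcup _ setT mx_cylinders).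

End measurable_matrix.

Section euclidean.
Context {R : realType}.
Local Open Scope ereal_scope.

(* The library norm on matrices is the sup norm; it induces the same topology,
   so [closed] below is unambiguous. *)
Definition l2norm p (x : 'cV[R]_p) : R := Num.sqrt (\sum_i x i ord0 ^+ 2)%R.

Definition unit_ball p : set 'cV[R]_p := [set x | (l2norm x <= 1)%R].

Definition closed_convex_cone p (T : set 'cV[R]_p) : Prop :=
  [/\ T !=set0, closed T, convex_set (T : set (convex_lmodType 'cV[R]_p)) &
      forall (t : R) x, (0 <= t)%R -> T x -> T (t *: x)%R].

(* Infimum of cardinalities, equal to +oo when there is no finite net. *)
Definition covering_number p (K : set 'cV[R]_p) (eps : R) : \bar R :=
  ereal_inf [set (#|` S|%:R)%:E | S in [set S : {fset 'cV[R]_p} |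
    [set` S] `<=` K /\
    forall x, K x -> exists2 y, y \in S & (l2norm (x - y) < eps)%R]].

Definition sudakov p (K : set 'cV[R]_p) : \bar R :=
  ereal_sup [set eps%:E * sqrte (lne (covering_number K eps)) |
    eps in [set eps : R | (0 < eps)%R]].

(* The [n]-fold product of a measure on the line, as a set function on column
   vectors of size [n]. *)
Fixpoint mpow (mu : set R -> \bar R) (n : nat) : set 'cV[R]_n -> \bar R :=
  match n with
  | 0 => \d_(0%R : 'cV[R]_0)
  | n'.+1 => pushforward (mu \x @mpow mu n')
      (fun xv : R * 'cV[R]_n' => col_mx (xv.1)%:M%R xv.2 : 'cV[R]_n'.+1)
  end.
Arguments mpow mu n A : clear implicits.

Definition volume p : set 'cV[R]_p -> \bar R :=
  mpow lebesgue_measure p.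

Definition volume_ratio p (K : set 'cV[R]_p) : \bar R :=
  (Num.sqrt p%:R)%:E *
    poweR (volume K / volume (@unit_ball p)) (p%:R^-1)%R.

(* The law N(0, s^2 I_n): [normal_prob] takes the standard deviation. *)
Definition isotropic_gaussian (n : nat) (s : R) : set 'cV[R]_n -> \bar R :=
  mpow (normal_prob 0%R s) n.

Definition image_radius p n (X : 'M[R]_(n, p)) (K : set 'cV[R]_p) : \bar R :=
  ereal_sup [set (l2norm (X *m v)%R)%:E | v in K].

(* Estimators are functions of the design and the observation; the risk is
   computed at the given design [X]. *)
Definition minimax_risk d (Omega : measurableType d) (P : probability Omega R)
    p n (X : 'M[R]_(n, p)) (Z : Omega -> 'cV[R]_n) (T : set 'cV[R]_p) : \bar R :=
  ereal_inf [set
    ereal_sup [set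
      'E_P[fun w => (l2norm (Mhat (X, X *m M + Z w) - M) ^+ 2)%R] | M in T]
    | Mhat in [set Mhat : 'M[R]_(n, p) * 'cV[R]_n -> 'cV[R]_p |
                measurable_fun setT Mhat]].

End euclidean.

Arguments mpow {R} mu n A.

(* Main.v *)
From HB Require Import structures.
Require Import Defs.
From mathcomp Require Import all_boot all_order all_algebra finmap.
From mathcomp Require Import all_classical all_reals all_analysis.
From mathcomp Require Import measurable_realfun ring lra.
Import Order.TTheory GRing.Theory Num.Theory.
Import numFieldTopology.Exports numFieldNormedType.Exports.
Local Open Scope classical_set_scope.
Local Open Scope ring_scope.
Local Open Scope ereal_scope.

(* Put K = B_2^p `&` T.  If f_1, .., f_k is an eps-packing of K, then the points
   t f_i lie in the cone T, are t eps-separated, and their images under the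
   design have norm at most t psi.  By a chi-square (Cameron-Martin) bound, k
   Gaussian shifts of squared norm at most (ln k / 2) s^2 cannot be told apart
   with average success probability larger than k^(-1/4), so choosing t^2 of
   order s^2 ln k / psi^2 gives a risk of order s^2 eps^2 ln k / psi^2.  A
   maximal packing is a net, whence the Sudakov bound.  The volume bound then
   follows from the Sudakov bound, because v(K) <= e * e(K): a net of radius
   eps = (vol K / vol B)^(1/p) / e has at least e^p points by comparison of
   volumes. *)

(** * Iterated product measures on column vectors *)

Section matrix_measurability.
Context {d} {T : measurableType d} (m n : nat).

Lemma measurable_mx_entry (i : 'I_m) (j : 'I_n) :
  measurable_fun setT (fun A : 'M[T]_(m, n) => A i j).
Proof.
move=> _ B mB; rewrite setTI; apply: sub_sigma_algebra.
by exists (i, j) => //=; exists B => //; rewrite setTI.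
Qed.

Lemma measurable_fun_mx d' (U : measurableType d') (f : U -> 'M[T]_(m, n)) :
  (forall i j, measurable_fun setT (fun u => f u i j)) ->
  measurable_fun setT f.
Proof.
move=> mf; apply: (measurability (@mx_cylinders _ T m n)) => //.
move=> _ [_ [ij _ [B mB <-]] <-]; rewrite setTI.
by rewrite setTI -comp_preimage -[_ @^-1` _]setTI; exact: mf.
Qed.

End matrix_measurability.


Section cons_column.
Context {R : realType} {n : nat}.

Definition cons_cV (xv : R * 'cV[R]_n) : 'cV[R]_n.+1 := col_mx (xv.1)%:M%R xv.2.

Definition tail_cV (v : 'cV[R]_n.+1) : 'cV[R]_n := \col_i v (lift ord0 i) ord0.

Lemma cons_cV0 xv : cons_cV xv ord0 ord0 = xv.1.
Proof.
have := col_mxEu (xv.1)%:M%R xv.2 ord0 ord0.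
by rewrite [RHS]mxE eqxx mulr1n => <-; congr (_ _ _); exact/val_inj.
Qed.

Lemma cons_cV_lift xv i : cons_cV xv (lift ord0 i) ord0 = xv.2 i ord0.
Proof.
rewrite -(col_mxEd (xv.1)%:M%R xv.2) /cons_cV.
by congr (_ _ _); exact/val_inj.
Qed.

Lemma cons_cVK xv : (cons_cV xv ord0 ord0, tail_cV (cons_cV xv)) = xv.
Proof.
case: xv => x v; rewrite cons_cV0; congr pair.
by apply/colP => i; rewrite mxE cons_cV_lift.
Qed.

Lemma tail_cVK (v : 'cV[R]_n.+1) : cons_cV (v ord0 ord0, tail_cV v) = v.
Proof.
apply/colP => i; have [j ->|->] := unliftP ord0 i.
  by rewrite cons_cV_lift mxE.
by rewrite cons_cV0.
Qed.

Lemma cons_cV_affine (a : R) x v y w :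
  cons_cV (x + a * y, v + a *: w)%R = (cons_cV (x, v) + a *: cons_cV (y, w))%R.
Proof.
apply/colP => i; have [j ->|->] := unliftP ord0 i.
  rewrite cons_cV_lift [RHS]mxE [X in _ = (_ + X)%R]mxE 2!cons_cV_lift /=.
  by rewrite !mxE.
by rewrite cons_cV0 [RHS]mxE [X in _ = (_ + X)%R]mxE 2!cons_cV0.
Qed.

Lemma measurable_cons_cV : measurable_fun setT cons_cV.
Proof.
apply: measurable_fun_mx => i j; rewrite ord1.
have [k ->|->] := unliftP ord0 i.
  rewrite (_ : (fun _ => _) = (fun v : 'cV[R]_n => v k ord0) \o snd).
    by apply: measurableT_comp => //; exact: measurable_mx_entry.
  by apply/funext => xv /=; rewrite cons_cV_lift.
rewrite (_ : (fun _ => _) = fst) //.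
by apply/funext => xv /=; rewrite cons_cV0.
Qed.

Lemma measurable_uncons_cV :
  measurable_fun setT (fun v : 'cV[R]_n.+1 => (v ord0 ord0, tail_cV v)).
Proof.
apply/measurable_fun_pairP; split => /=; first exact: measurable_mx_entry.
apply: measurable_fun_mx => i j.
rewrite (_ : (fun _ => _) = fun v : 'cV[R]_n.+1 => v (lift ord0 i) ord0).
  exact: measurable_mx_entry.
by apply/funext => v; rewrite /= mxE.
Qed.

End cons_column.

Lemma pushforward_measure {d1 d2} {T1 : measurableType d1}
    {T2 : measurableType d2} {R : realType} (mu : {measure set T1 -> \bar R})
    (f : T1 -> T2) : measurable_fun setT f ->
  exists nu : {measure set T2 -> \bar R}, pushforward mu f = nu :> (set _ -> _).
Proof.
move=> mf.
by exists
  (measure_function_pushforward__canonical__measure_function_Measure mu mf).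
Qed.

Section mpow_measure.
Context {R : realType}.

Lemma mpowS (mu : set R -> \bar R) n (A : set 'cV[R]_n.+1) :
  mpow mu n.+1 A = \int[mu]_x mpow mu n [set v | A (cons_cV (x, v))].
Proof.
rewrite /= /pushforward /product_measure1; congr integral; apply/funext => x /=.
by congr (mpow _ _ _); apply/funext => v; rewrite /xsection /= inE.
Qed.

Lemma mpow_measure (mu : {sigma_finite_measure set R -> \bar R}) n :
  exists m : {sigma_finite_measure set 'cV[R]_n -> \bar R},
    mpow mu n = m :> (set _ -> _).
Proof.
elim: n => [|n [m IH]] /=.
  by exists (\d_(0%R : 'cV[R]_0)).
rewrite IH.
have [nu nuE] := pushforward_measure (mu \x m) _ (@measurable_cons_cV R n).
have sf : sigma_finite setT nu.
  have /sigma_finiteP[F [TF ndF Foo]] := sigma_finiteT mu.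
  have /sigma_finiteP[G [TG ndG Goo]] := sigma_finiteT m.
  pose g := fun v : 'cV[R]_n.+1 => (v ord0 ord0, tail_cV v).
  exists (fun k => g @^-1` (F k `*` G k)).
    apply/esym; rewrite -subTset => v _.
    have [i _ Fi] : (\bigcup_i F i) (g v).1 by rewrite -TF.
    have [j _ Gj] : (\bigcup_i G i) (g v).2 by rewrite -TG.
    exists (maxn i j) => //; split.
      by move: Fi; apply/subsetPset/ndF/leq_maxl.
    by move: Gj; apply/subsetPset/ndG/leq_maxr.
  move=> k; have [mF Fk] := Foo k; have [mG Gk] := Goo k.
  split.
    rewrite -[_ @^-1` _]setTI.
    by apply: measurable_uncons_cV => //; exact: measurableX.
  rewrite -nuE /pushforward /= -comp_preimage.
  rewrite (_ : g \o _ = id); last by apply/funext => xv; exact: cons_cVK.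
  by rewrite preimage_id product_measure1E// lte_mul_pinfty// ge0_fin_numE.
pose sfm := isSigmaFinite.Build _ _ _ (nu : set _ -> \bar R) sf.
pose sfn := isSFinite.Build _ _ _ (nu : set _ -> \bar R)
  (sfinite_measure_sigma_finite sf).
pose nu' : {sigma_finite_measure set 'cV[R]_n.+1 -> \bar R} :=
  HB.pack (Measure.sort nu) (Measure.class nu) sfm sfn.
by exists nu'.
Qed.

Lemma measurable_mpow_section (mu : {sigma_finite_measure set R -> \bar R}) n
    (A : set 'cV[R]_n.+1) : measurable A ->
  measurable_fun setT
    (fun x => mpow mu n [set v | A (cons_cV (x, v))] : \bar R).
Proof.
move=> mA; have [m ->] := mpow_measure mu n.
have mA' : measurable (cons_cV @^-1` A).
  by rewrite -[_ @^-1` _]setTI; exact: measurable_cons_cV.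
apply: eq_measurable_fun (measurable_fun_xsection m mA') => x _ /=.
by congr (m _); apply/funext => v; rewrite /xsection /= inE.
Qed.

Lemma ge0_le_integralT d (T : measurableType d)
    (mu : {measure set T -> \bar R}) (f g : T -> \bar R) :
  (forall x, 0 <= f x) -> (forall x, f x <= g x) ->
  \int[mu]_x f x <= \int[mu]_x g x.
Proof.
move=> f0 fg; have g0 x : 0 <= g x by exact: le_trans (fg x).
rewrite !ge0_integralTE//; apply: ge_ereal_sup => _ [h hf <-].
by apply: ereal_sup_ubound; exists h => // x; exact: le_trans (fg x).
Qed.

Lemma mpow_ge0 (mu : {measure set R -> \bar R}) n A : 0 <= mpow mu n A.
Proof.
elim: n A => [A|n IH A] //.
by rewrite mpowS; exact: integral_ge0.
Qed.

(* No measurability is needed here: the integral of an arbitrary nonnegative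
   function is a supremum over the simple functions below it. *)
Lemma le_mpow (mu : {measure set R -> \bar R}) n A B :
  A `<=` B -> mpow mu n A <= mpow mu n B.
Proof.
elim: n A B => [A B AB|n IH A B AB].
  rewrite /= !diracE lee_fin ler_nat.
  case: (boolP (0%R \in A)) => // /set_mem A0.
  by rewrite mem_set//; exact: AB.
rewrite !mpowS; apply: ge0_le_integralT => x; first exact: mpow_ge0.
by apply: IH => v; exact: AB.
Qed.

End mpow_measure.

(** * Affine maps and volumes *)

Section borel_copy.
Context {R : realType}.

(* [lebesgue_measure] and [normal_prob] live on [measurableTypeR R], whose
   measurable sets are those of [R] but whose display is different; Defs.v uses
   [R] itself, so both measures have to be transported. *)
Definition borel_copy (m : set (measurableTypeR R) -> \bar R)
  : set R -> \bar R := m.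

Section measure_copy.
Variable m : {measure set (measurableTypeR R) -> \bar R}.
HB.instance Definition _ := isMeasure.Build _ R _ (borel_copy m)
  (measure0 m) (fun A => measure_ge0 m A)
  (@measure_semi_sigma_additive _ _ _ m).
End measure_copy.

Section sfin_copy.
Variable m : {sigma_finite_measure set (measurableTypeR R) -> \bar R}.
HB.instance Definition _ := Measure.on (borel_copy m).
HB.instance Definition _ := @Measure_isSigmaFinite.Build _ R _ (borel_copy m)
  (@sigma_finiteT _ _ _ m).
End sfin_copy.
Section prob_copy.
Variable m : probability (measurableTypeR R) R.
HB.instance Definition _ := Measure.on (borel_copy m).
HB.instance Definition _ := @Measure_isProbability.Build _ R _ (borel_copy m)
  (@probability_setT _ _ _ m).
End prob_copy.

Lemma ge0_integral_copy (m : {measure set (measurableTypeR R) -> \bar R})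
    (f : R -> \bar R) :
  measurable_fun setT f -> (forall x, 0 <= f x) ->
  \int[borel_copy m]_x f x = \int[m]_x f x.
Proof.
move=> mf f0.
have mi : measurable_fun setT (fun x : measurableTypeR R => x : R).
  by move=> _ B mB; rewrite setTI.
transitivity (\int[pushforward m (fun x : measurableTypeR R => x : R)]_x f x).
  done. 
by rewrite ge0_integral_pushforward.
Qed.
End borel_copy.

Section lebesgue_affine.
Context {R : realType}.
Local Notation mu := (@lebesgue_measure R).

Lemma lebesgue_measure_affine (a e : R) (A : set R) : (0 < e)%R ->
  measurable A -> mu [set x | A (a + e * x)%R] = (e^-1)%:E * mu A.
Proof.
move=> e0 mA.
have mf : measurable_fun setT
    (fun x : measurableTypeR R => (a + e * x)%R : measurableTypeR R).
  by apply: measurable_funD => //; exact: measurable_funM.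
have [nu nuE] := pushforward_measure mu _ mf.
have e0' : (0 <= e)%R by exact: ltW.
have sE B : mscale (NngNum e0') nu B = e%:E * mu [set x | B (a + e * x)%R].
  by congr (_ * _); exact: esym (congr1 (fun m => m B) nuE).
suff H X : ocitv X -> mu X = mscale (NngNum e0') nu X.
  rewrite (etrans (lebesgue_measure_unique H mA) (sE A)).
  by rewrite muleA -EFinM mulVf ?gt_eqF// mul1e.
move=> [[b c] _ <-]; apply: etrans (esym (sE _)).
have -> : [set x : R | `]b, c]%classic (a + e * x)%R] =
    `]((b - a) / e)%R, ((c - a) / e)%R]%classic.
  apply/seteqP; split => x /=; rewrite !in_itv /= ltr_pdivrMr// ler_pdivlMr//.
    by rewrite ltrBlDl lerBrDl (mulrC x).
  by rewrite ltrBlDl lerBrDl (mulrC x).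
rewrite !lebesgue_measure_itv /= !lte_fin ltr_pM2r ?invr_gt0// ltrD2r.
case: ifPn => // _; last by rewrite mule0.
by rewrite -!EFinB -EFinM; congr EFin; field; rewrite gt_eqF.
Qed.

Lemma ge0_integral_affine (a e : R) (g : R -> \bar R) : (0 < e)%R ->
  measurable_fun setT g -> (forall x, 0 <= g x) ->
  \int[borel_copy mu]_x g (a + e * x)%R
    = (e^-1)%:E * \int[borel_copy mu]_x g x.
Proof.
move=> e0 mg g0.
have mf : measurable_fun setT (fun x : R => (a + e * x)%R).
  by apply: measurable_funD => //; exact: measurable_funM.
have ei0 : (0 <= e^-1)%R by rewrite invr_ge0 ltW.
transitivity
  (\int[pushforward (borel_copy mu) (fun x : R => (a + e * x)%R)]_x g x).
  by rewrite ge0_integral_pushforward.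
rewrite -(@ge0_integral_mscale _ _ _ (borel_copy mu) setT _ (NngNum ei0))//.
apply: eq_measure_integral => A mA _ /=.
by rewrite /pushforward /mscale /=; exact: lebesgue_measure_affine.
Qed.

End lebesgue_affine.

Section volume_affine.
Context {R : realType}.
Local Notation leb := (borel_copy (@lebesgue_measure R)).

Lemma measurable_cV_section n (A : set 'cV[R]_n.+1) x : measurable A ->
  measurable [set v : 'cV[R]_n | A (cons_cV (x, v))].
Proof.
move=> mA; rewrite -[[set _ | _]]setTI.
exact: (measurableT_comp measurable_cons_cV (pair1_measurable x)).
Qed.

Lemma volume_affine n (c : 'cV[R]_n) (e : R) (A : set 'cV[R]_n) : (0 < e)%R ->
  measurable A -> volume [set v | A (c + e *: v)%R] = (e^-1 ^+ n)%:E * volume A.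
Proof.
move=> e0; rewrite /volume -[lebesgue_measure]/(leb).
elim: n c A => [c A mA|n IH c A mA].
  rewrite expr0 mul1e; congr (mpow _ _ _); apply/seteqP.
  by split=> v /=; rewrite !flatmx0.
have en0 : 0 <= (e^-1 ^+ n)%:E by rewrite lee_fin exprn_ge0// invr_ge0 ltW.
have mS := measurable_mpow_section leb n A mA.
rewrite !mpowS.
transitivity (\int[leb]_x ((e^-1 ^+ n)%:E *
    mpow leb n [set v | A (cons_cV ((c ord0 ord0 + e * x)%R, v))])).
  apply: eq_integral => x _; rewrite -(IH (tail_cV c)); last first.
    exact: measurable_cV_section.
  congr mpow; apply/funext => v.
  by rewrite /= cons_cV_affine tail_cVK.
rewrite ge0_integralZl//=; last 2 first.
- apply: (measurableT_comp mS).
  by apply: measurable_funD => //; exact: measurable_funM.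
- by move=> *; exact: mpow_ge0.
rewrite (ge0_integral_affine _ _ _ e0 mS); last by move=> ?; exact: mpow_ge0.
by rewrite muleA -EFinM -exprSr.
Qed.

End volume_affine.

(** * Shifts of Gaussian measures *)

Section density.
Context {d} {T : measurableType d} {R : realType}.
Variables (mu nu : {measure set T -> \bar R}) (g : T -> R).
Hypotheses (g0 : forall x, (0 <= g x)%R) (mg : measurable_fun setT g).
Hypothesis nuE : forall A, measurable A -> nu A = \int[mu]_(x in A) (g x)%:E.

Import HBNNSimple.

Lemma ge0_integral_density (f : T -> \bar R) :
  measurable_fun setT f -> (forall x, 0 <= f x) ->
  \int[nu]_x f x = \int[mu]_x (f x * (g x)%:E).
Proof.
move=> mf f0.
have mgE : measurable_fun setT (EFin \o g) by exact/measurable_EFinP.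
pose h := nnsfun_approx measurableT mf.
have hf x : (h n x)%:E @[n --> \oo] --> f x by exact: cvg_nnsfun_approx.
have nd_h x : {homo (fun n => (h n x)%:E) : m n / (m <= n)%N >-> m <= n}.
  by move=> m n mn; rewrite lee_fin; exact/lefP/nd_nnsfun_approx.
have simple n : \int[nu]_x (h n x)%:E = \int[mu]_x ((h n x)%:E * (g x)%:E).
  have hE x : (h n x)%:E =
      \sum_(y \in range (h n)) (y * \1_(h n @^-1` [set y]) x)%:E.
    by rewrite fimfunE -fsumEFin.
  have mi y : measurable_fun setT (fun x => (y * \1_(h n @^-1` [set y]) x)%:E).
    by apply/measurable_EFinP; exact: measurable_funM.
  under eq_integral do rewrite hE.
  have i0 y x : 0 <= (y * \1_(h n @^-1` [set y]) x)%:E.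
    exact: nnfun_muleindic_ge0.
  rewrite ge0_integral_fsum//.
  under [RHS]eq_integral => x _.
    rewrite hE ge0_mule_fsuml//.
    over.
  rewrite ge0_integral_fsum//; last 2 first.
  - by move=> y; exact: emeasurable_funM.
  - by move=> y x _; rewrite mule_ge0 ?lee_fin// -lee_fin.
  apply: eq_fsbigr => y; rewrite inE => -[t _ <-].
  have mA : measurable (h n @^-1` [set h n t]) by exact: measurable_sfunP.
  under eq_integral do rewrite EFinM.
  rewrite ge0_integralZl ?lee_fin//; last exact/measurable_EFinP.
  under [RHS]eq_integral do rewrite EFinM -muleA.
  rewrite ge0_integralZl ?lee_fin//; last 2 first.
  - by apply: emeasurable_funM => //; exact/measurable_EFinP.
  - by move=> x _; rewrite mule_ge0 ?lee_fin.
  congr (_ * _); rewrite integral_indic// setIT nuE//.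
  rewrite integral_mkcond; apply: eq_integral => x _.
  by rewrite epatch_indic muleC.
transitivity (limn (fun n => \int[nu]_x (h n x)%:E)).
  rewrite -monotone_convergence//; last 2 first.
  - by move=> n; exact/measurable_EFinP.
  - by move=> n x _; rewrite lee_fin.
  by apply: eq_integral => x _; exact/esym/cvg_lim.
under eq_fun do rewrite simple.
rewrite -monotone_convergence//; last 3 first.
- by move=> n; apply: emeasurable_funM => //; exact/measurable_EFinP.
- by move=> n x _; rewrite mule_ge0 ?lee_fin.
- by move=> x _ m n mn; rewrite lee_wpmul2r ?lee_fin//; exact: nd_h.
apply: eq_integral => x _; apply/cvg_lim => //.
by apply: cvgeZr.
Qed.

End density.

Section gaussian_shift.
Context {R : realType} (s : R).
Hypothesis s0 : (0 < s)%R.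
Local Notation gauss := (borel_copy (normal_prob 0%R s)).
Local Notation leb := (borel_copy (@lebesgue_measure R)).

Lemma ge0_integral_normal (f : R -> \bar R) :
  measurable_fun setT f -> (forall x, 0 <= f x) ->
  \int[gauss]_x f x = \int[leb]_x (f x * (normal_pdf 0%R s x)%:E).
Proof.
move=> mf f0.
rewrite (ge0_integral_copy _ _ mf f0) ge0_integral_copy; last 2 first.
- apply: emeasurable_funM => //; apply/measurable_EFinP.
  exact: measurable_normal_pdf.
- by move=> x; rewrite mule_ge0// lee_fin normal_pdf_ge0.
apply: ge0_integral_density => //.
- by move=> x; exact: normal_pdf_ge0.
- exact: measurable_normal_pdf.
Qed.

Lemma cameron_martin (t : R) (f : R -> \bar R) :
  measurable_fun setT f -> (forall x, 0 <= f x) ->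
  \int[gauss]_x ((expR (- (2 * x * t + t ^+ 2) / (s ^+ 2 *+ 2)))%:E
      * f (t + x)%R)
  = \int[gauss]_x f x.
Proof.
move=> mf f0.
have mw : measurable_fun setT (fun x : R =>
    (expR (- (2 * x * t + t ^+ 2) / (s ^+ 2 *+ 2)))%:E).
  apply/measurable_EFinP; apply: measurableT_comp => //.
  apply: measurable_funM => //; apply: measurableT_comp => //.
  apply: measurable_funD => //; by do 2 apply: measurable_funM => //.
have mft : measurable_fun setT (fun x : R => f (t + x)%R).
  by apply: (measurableT_comp mf); exact: measurable_funD.
have mp : measurable_fun setT (fun x : R => (normal_pdf 0%R s x)%:E).
  by apply/measurable_EFinP; exact: measurable_normal_pdf.
have p0 x : 0 <= (normal_pdf 0%R s x)%:E by rewrite lee_fin normal_pdf_ge0.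
rewrite !ge0_integral_normal//; last 2 first.
- exact: emeasurable_funM.
- by move=> x; rewrite mule_ge0 ?lee_fin ?expR_ge0.
have := @ge0_integral_affine R t 1
  (fun x => f x * (normal_pdf 0%R s x)%:E) ltr01.
rewrite invr1 mul1e => <-; last 2 first.
- exact: emeasurable_funM.
- by move=> x; rewrite mule_ge0.
apply: eq_integral => x _; rewrite mul1r muleAC muleC; congr (_ * _).
rewrite -EFinM !normal_pdfE ?gt_eqF//; congr EFin.
rewrite mulrCA /normal_fun -expRD; congr (_ * expR _)%R.
rewrite -mulrDl; congr (_ / _)%R; ring.
Qed.

End gaussian_shift.

Section gaussian_tensor.
Context {R : realType} (s : R).
Hypothesis s0 : (0 < s)%R.
Local Notation gauss := (borel_copy (normal_prob 0%R s)).

Let w (t x : R) := expR (- (2 * x * t + t ^+ 2) / (s ^+ 2 *+ 2)).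

Let measurable_w t : measurable_fun setT (w t).
Proof.
apply: measurableT_comp => //.
apply: measurable_funM => //; apply: measurableT_comp => //.
by apply: measurable_funD => //; by do 2 apply: measurable_funM => //.
Qed.

Let measurable_winv t : measurable_fun setT (fun x => (w t x)^-1)%R.
Proof.
rewrite (_ : (fun _ => _) =
    fun x => expR ((2 * x * t + t ^+ 2) / (s ^+ 2 *+ 2))); last first.
  by apply/funext => x; rewrite /w -expRN mulNr opprK.
apply: measurableT_comp => //; apply: measurable_funM => //.
by apply: measurable_funD => //; by do 2 apply: measurable_funM => //.
Qed.

Lemma integral_normal_winv t :
  \int[gauss]_x ((w t x)^-1)%:E = (expR (t ^+ 2 / s ^+ 2))%:E.
Proof.
have := cameron_martin s s0 (- t) (cst 1) (measurable_cst _) (fun=> lee01).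
rewrite [RHS]integral_cst// mul1e [X in _ = X -> _](_ : _ = 1); last first.
  exact: (@probability_setT _ _ _ (normal_prob 0%R s)).
move=> H.
rewrite -[RHS]mule1 -[X in _ = _ * X]H -ge0_integralZl//; last 2 first.
- apply: emeasurable_funM => //; apply/measurable_EFinP.
  exact: (measurable_w (- t)).
- by move=> x _; rewrite /= mule1 lee_fin expR_ge0.
apply: eq_integral => x _; rewrite /= mule1 -EFinM -expRN -expRD.
congr (expR _)%:E.
by field; rewrite gt_eqF.
Qed.

(* This is [mu (A - th) <= sqrt (mu A) * exp (|th|^2 / (2 s^2))] after AM-GM
   with a free weight [lam]; in this affine form it tensorizes with [lam]
   replaced by [lam * w t x], which turns the two terms into Cameron-Martin integrals. *)
Lemma gaussian_shift n (th : 'cV[R]_n) (A : set 'cV[R]_n) (lam : R) :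
  measurable A -> (0 < lam)%R ->
  mpow gauss n [set v | A (th + v)%R] <=
  (lam / 2)%:E * mpow gauss n A
    + (expR ((\sum_i th i ord0 ^+ 2) / s ^+ 2) / (2 * lam))%:E.
Proof.
elim: n th A lam => [|n IH] th A lam mA lam0.
  rewrite big_ord0 mul0r expR0.
  rewrite (_ : [set _ | _] = A); last first.
    by apply/seteqP; split => v /=; rewrite (flatmx0 (th + v)%R) (flatmx0 v).
  rewrite /= diracE; case: (_ \in _); rewrite -EFinM -EFinD lee_fin.
    rewrite mulr1 -subr_ge0.
    rewrite (_ : _ - _ = (lam - 1) ^+ 2 / (2 * lam))%R; last first.
      by rewrite mulr1n; field; rewrite gt_eqF.
    by rewrite divr_ge0 ?sqr_ge0// mulr_ge0 ?ltW.
  by rewrite mulr0 add0r divr_ge0// mulr_ge0 ?ltW.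
set t := th ord0 ord0; set th' := tail_cV th.
have -> : (\sum_i th i ord0 ^+ 2 = t ^+ 2 + \sum_i th' i ord0 ^+ 2)%R.
  rewrite big_ord_recl; congr (_ + _)%R.
  by apply: eq_bigr => i _; rewrite mxE.
set q := (\sum_i _)%R.
pose F x := mpow gauss n [set v | A (cons_cV (x, v))].
have mF : measurable_fun setT F := measurable_mpow_section gauss n A mA.
have F0 x : 0 <= F x by exact: mpow_ge0.
have mFt : measurable_fun setT (fun x => F (t + x)%R).
  by apply: (measurableT_comp mF); exact: measurable_funD.
have ww x : (0 < w t x)%R by exact: expR_gt0.
have mwE : measurable_fun setT (fun x => (w t x)%:E).
  apply/measurable_EFinP; exact: measurable_w.
have mwiE : measurable_fun setT (fun x => ((w t x)^-1)%:E).
  apply/measurable_EFinP; exact: measurable_winv.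
have c0 : (0 <= expR (q / s ^+ 2) / (2 * lam))%R.
  by rewrite divr_ge0 ?expR_ge0// mulr_ge0// ltW.
rewrite !mpowS.
apply: (@le_trans _ _ (\int[gauss]_x ((lam / 2)%:E * ((w t x)%:E * F (t + x)%R)
   + (expR (q / s ^+ 2) / (2 * lam))%:E * ((w t x)^-1)%:E))).
  apply: ge0_le_integralT => x; first exact: mpow_ge0.
  rewrite (_ : [set _ | _] = [set v | A (cons_cV ((t + x)%R, th' + v)%R)]).
    have mAx := measurable_cV_section _ A (t + x)%R mA.
    have lw : (0 < lam * w t x)%R by rewrite mulr_gt0.
    apply: le_trans (IH th' _ _ mAx lw) _.
    rewrite muleA -EFinM -EFinM mulrAC leeD2l// lee_fin -/q.
    by rewrite le_eqVlt; apply/orP; left; apply/eqP; field; rewrite !gt_eqF.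
  apply/funext => v /=; congr A.
  rewrite -[in LHS](tail_cVK th) -[x in LHS]mul1r -[v in LHS]scale1r.
  by have := cons_cV_affine 1 t th' x v; rewrite !scale1r mul1r => ->.
rewrite ge0_integralD//; last 4 first.
- by move=> x _; rewrite !mule_ge0 ?lee_fin ?divr_ge0// ltW.
- by do 2 apply: emeasurable_funM => //.
- by move=> x _; rewrite !mule_ge0 ?lee_fin ?invr_ge0// ltW.
- by apply: emeasurable_funM.
rewrite !ge0_integralZl//; last 4 first.
- by move=> x _; rewrite lee_fin invr_ge0 ltW.
- exact: emeasurable_funM.
- by move=> x _; rewrite mule_ge0 ?lee_fin// ltW.
- by rewrite lee_fin divr_ge0// ltW.
rewrite integral_normal_winv (cameron_martin _ s0)// -EFinM leeD2l// lee_fin.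
rewrite (mulrDl (t ^+ 2)%R) expRD le_eqVlt; apply/orP; left; apply/eqP.
by field; rewrite !gt_eqF.
Qed.

End gaussian_tensor.

(** * From tests to risk *)

Section squared_norm.
Context {R : realType} {p : nat}.
Implicit Types x y : 'cV[R]_p.

Definition sqnorm x : R := (\sum_i x i ord0 ^+ 2)%R.

Lemma sqnorm_ge0 x : (0 <= sqnorm x)%R.
Proof. by apply: sumr_ge0 => i _; exact: sqr_ge0. Qed.

Lemma l2norm_ge0 x : (0 <= l2norm x)%R.
Proof. exact: sqrtr_ge0. Qed.

Lemma sqr_l2norm x : (l2norm x ^+ 2 = sqnorm x)%R.
Proof. by rewrite sqr_sqrtr// sqnorm_ge0. Qed.

Lemma sqnormZ a x : (sqnorm (a *: x) = a ^+ 2 * sqnorm x)%R.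
Proof.
rewrite /sqnorm mulr_sumr; apply: eq_bigr => i _.
by rewrite mxE exprMn.
Qed.

Lemma l2normZ a x : (l2norm (a *: x) = `|a| * l2norm x)%R.
Proof.
rewrite /l2norm -!/(sqnorm _) sqnormZ sqrtrM ?sqr_ge0//.
by rewrite sqrtr_sqr.
Qed.

Lemma l2norm0 : (l2norm (0 : 'cV[R]_p) = 0)%R.
Proof. by rewrite -(scale0r (0 : 'cV[R]_p)) l2normZ normr0 mul0r. Qed.

Lemma sqnormB_le x y z :
  (sqnorm (x - y) <= 2 * (sqnorm (z - x) + sqnorm (z - y)))%R.
Proof.
rewrite /sqnorm -big_split mulr_sumr; apply: ler_sum => i _.
rewrite !mxE /= -subr_ge0.
rewrite (_ : _ - _ = (z i ord0 - x i ord0 + (z i ord0 - y i ord0)) ^+ 2)%R.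
  exact: sqr_ge0.
ring.
Qed.

Lemma measurable_sqnorm d (T : measurableType d) (f : T -> 'cV[R]_p)
    (c : 'cV[R]_p) :
  measurable_fun setT f -> measurable_fun setT (fun t => sqnorm (f t - c)%R).
Proof.
move=> mf; apply: measurable_sum => i.
apply: measurable_funX; rewrite [X in measurable_fun _ X](_ : _ =
    (fun t => f t i ord0 - c i ord0)%R); last first.
  by apply/funext => t; rewrite !mxE.
apply: measurable_funB => //.
exact: (measurableT_comp (measurable_mx_entry _ _ i ord0) mf).
Qed.

End squared_norm.

Lemma mpow_setT {R : realType} (mu : probability R R) n :
  mpow mu n [set: 'cV[R]_n] = 1.
Proof.
elim: n => [|n IH]; first by rewrite /= diracT.
rewrite mpowS (eq_integral (cst 1)); last by move=> x _; exact: IH.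
by rewrite integral_cst// mul1e; exact: probability_setT.
Qed.

Lemma sum_measure_disjoint_le {d} {T : measurableType d} {R : realType}
    (mu : {measure set T -> \bar R}) (k : nat) (A : 'I_k -> set T) :
  (forall i, measurable (A i)) ->
  (forall i j t, A i t -> A j t -> i = j) ->
  \sum_(i < k) mu (A i) <= mu setT.
Proof.
move=> mA dA.
have fT : finite_set [set: 'I_k] by exact: finite_finset.
have bU : mu (\bigcup_(i in [set: 'I_k]) A i) = \sum_(i < k) mu (A i).
  rewrite (measure_fin_bigcup mu fT)//; last first.
    by move=> i j _ _ [t [Ai Aj]]; exact: dA Ai Aj.
  rewrite (_ : [set: 'I_k] = [set` enum 'I_k]).
    by rewrite -fsbig_seq ?enum_uniq// big_enum.
  by apply/seteqP; split => i //= _; rewrite mem_enum.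
rewrite -bU; apply: le_measure; rewrite ?inE//.
exact: fin_bigcup_measurable.
Qed.

Section gaussian_testing.
Context {R : realType} (s : R).
Hypothesis s0 : (0 < s)%R.
Local Notation gauss := (borel_copy (normal_prob 0%R s)).

(* With [k = q^4], the average probability of guessing the right shift is at
   most [1 / q]. *)
Lemma gaussian_testing n k (th : 'I_k -> 'cV[R]_n) (A : 'I_k -> set 'cV[R]_n)
    (q : R) : (0 < q)%R -> (k%:R = q ^+ 4)%R ->
  (forall i, expR (sqnorm (th i) / s ^+ 2) <= q ^+ 2)%R ->
  (forall i, measurable (A i)) ->
  (forall i j y, A i y -> A j y -> i = j) ->
  \sum_(i < k) mpow gauss n [set v | A i (th i + v)%R] <= (q ^+ 3)%:E.
Proof.
move=> q0 kq thq mA dA.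
have q30 : (0 < q ^+ 3)%R by rewrite exprn_gt0.
apply: (@le_trans _ _ (\sum_(i < k) ((q ^+ 3 / 2)%:E * mpow gauss n (A i)
    + (q^-1 / 2)%:E))).
  apply: lee_sum => i _.
  apply: le_trans (gaussian_shift _ s0 _ _ _ _ (mA i) q30) _.
  rewrite leeD2l// lee_fin -/(sqnorm _) ler_pdivrMr ?mulr_gt0//.
  apply: le_trans (thq i) _; rewrite le_eqVlt; apply/orP; left; apply/eqP.
  by field; rewrite gt_eqF.
rewrite big_split /= -ge0_sume_distrr; last by move=> i _; exact: mpow_ge0.
rewrite sumEFin sumr_const card_ord -(mulr_natl (q^-1 / 2)%R k) kq.
apply: (@le_trans _ _ ((q ^+ 3 / 2)%:E * 1 + (q ^+ 4 * (q^-1 / 2))%:E)).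
  apply: leeD => //; apply: lee_wpmul2l; first by rewrite lee_fin divr_ge0 ?ltW.
  have [m mE] := mpow_measure gauss n.
  rewrite mE -(mpow_setT gauss n) mE.
  exact: sum_measure_disjoint_le.
rewrite mule1 -EFinD lee_fin le_eqVlt; apply/orP; left; apply/eqP.
by field; rewrite gt_eqF.
Qed.

End gaussian_testing.

Lemma expectation_ge_cst {d} {T : measurableType d} {R : realType}
    (P : probability T R) (f : T -> R) (c : R) (B : set T) :
  (0 <= c)%R -> (forall t, (0 <= f t)%R) -> measurable B ->
  (forall t, B t -> (c <= f t)%R) -> c%:E * P B <= 'E_P[f].
Proof.
move=> c0 f0 mB Bf; rewrite unlock.
apply: (@le_trans _ _ (\int[P]_t (c%:E * (\1_B t)%:E))).
  rewrite ge0_integralZl//; first by rewrite integral_indic// setIT.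
  by apply/measurable_EFinP; exact: measurable_indic.
apply: ge0_le_integralT => t; first by rewrite mule_ge0// lee_fin.
rewrite -EFinM lee_fin indicE; case: (boolP (t \in B)) => tB.
  by rewrite mulr1; apply: Bf; rewrite inE in tB.
by rewrite mulr0.
Qed.

Lemma measurable_addl_cV {R : realType} n (c : 'cV[R]_n) :
  measurable_fun setT (fun v : 'cV[R]_n => c + v)%R.
Proof.
apply: measurable_fun_mx => i j.
rewrite (_ : (fun _ => _) = (fun v : 'cV[R]_n => c i j + v i j)%R).
  by apply: measurable_funD => //; exact: measurable_mx_entry.
by apply/funext => v; rewrite mxE.
Qed.

Section risk.
Context {R : realType} {d} {Omega : measurableType d} (P : probability Omega R).
Context {p n : nat} (X : 'M[R]_(n, p)) (Z : {RV P >-> 'cV[R]_n}) (s : R).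
Hypothesis s0 : (0 < s)%R.
Hypothesis Z_law : forall A : set 'cV[R]_n, measurable A ->
  distribution P Z A = isotropic_gaussian s A.
Local Notation gauss := (borel_copy (normal_prob 0%R s)).

Lemma risk_ge (Mhat : 'M[R]_(n, p) * 'cV[R]_n -> 'cV[R]_p) (k : nat)
    (M : 'I_k -> 'cV[R]_p) (delta q r : R) :
  measurable_fun setT Mhat ->
  (forall i, 'E_P[fun w => (l2norm (Mhat (X, X *m M i + Z w) - M i) ^+ 2)%R]
     <= r%:E) ->
  (0 <= delta)%R -> (forall i j, i != j -> delta <= sqnorm (M i - M j))%R ->
  (0 < q)%R -> (k%:R = q ^+ 4)%R ->
  (forall i, expR (sqnorm (X *m M i) / s ^+ 2) <= q ^+ 2)%R ->
  (delta / 4 * (1 - q^-1) <= r)%R.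
Proof.
move=> mMhat riskr delta0 sepM q0 kq Mq.
pose f i y := sqnorm (Mhat (X, y) - M i)%R.
have mf i : measurable_fun setT (f i).
  by apply/measurable_sqnorm/(measurableT_comp mMhat)/pair1_measurable.
pose A i := [set y | (f i y < delta / 4)%R].
have mA i : measurable (A i).
  rewrite (_ : A i = f i @^-1` `]-oo, (delta / 4)%R[).
    by rewrite -[_ @^-1` _]setTI; exact: mf.
  by apply/seteqP; split => y /=; rewrite in_itv.
have dA i j y : A i y -> A j y -> i = j.
  move=> Ai Aj; apply/eqP; apply: contraT => ij.
  have := sepM _ _ ij; have := sqnormB_le (M i) (M j) (Mhat (X, y)).
  by rewrite /A /f /= in Ai Aj *; lra.
have mAs i : measurable [set v | A i (X *m M i + v)%R].
  by rewrite -[[set _ | _]]setTI; exact: measurable_addl_cV.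
pose B i := [set w | A i (X *m M i + Z w)%R].
have mB i : measurable (B i).
  rewrite (_ : B i = Z @^-1` [set v | A i (X *m M i + v)%R])//.
  by rewrite -[_ @^-1` _]setTI; exact: measurable_funP.
have PB i : P (B i) = mpow gauss n [set v | A i (X *m M i + v)%R].
  exact: (Z_law _ (mAs i)).
have sumP : \sum_(i < k) P (B i) <= (q ^+ 3)%:E.
  under eq_bigr do rewrite PB.
  exact: gaussian_testing.
pose b i := fine (P (B i)).
have bE i : P (B i) = (b i)%:E by rewrite fineK// fin_num_measure.
have sumb : (\sum_(i < k) b i <= q ^+ 3)%R.
  by rewrite -lee_fin -sumEFin; under eq_bigr do rewrite -bE.
have rb i : (delta / 4 * (1 - b i) <= r)%R.
  rewrite -lee_fin; apply: le_trans (riskr i).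
  rewrite EFinM EFinB -bE -probability_setC//.
  apply: expectation_ge_cst.
  - by rewrite divr_ge0.
  - by move=> w; exact: sqr_ge0.
  - exact: measurableC.
  - by move=> w; rewrite /B /A /f /= sqr_l2norm => /negP; rewrite -leNgt.
have : (\sum_(i < k) delta / 4 * (1 - b i) <= \sum_(i < k) r)%R.
  exact: ler_sum.
rewrite -mulr_sumr sumrB !sumr_const card_ord -(mulr_natl r k) kq => H.
rewrite -(ler_pM2l (exprn_gt0 4%N q0)); apply: le_trans H.
rewrite mulrCA ler_wpM2l ?divr_ge0//.
rewrite (_ : q ^+ 4 * _ = q ^+ 4 - q ^+ 3)%R; last by field; rewrite gt_eqF.
exact: lerB.
Qed.

End risk.

(** * Packings, Sudakov estimate and volume ratio *)

Section packing.
Context {R : realType} {p : nat}.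
Implicit Types (K : set 'cV[R]_p) (eps : R).

Definition packing K eps k (f : 'I_k -> 'cV[R]_p) : Prop :=
  (forall i, K (f i)) /\ (forall i j, i != j -> eps <= l2norm (f i - f j))%R.

Lemma l2normC (x y : 'cV[R]_p) : l2norm (x - y)%R = l2norm (y - x)%R.
Proof.
by rewrite -opprB -scaleN1r l2normZ normrN1 mul1r.
Qed.

Lemma maximal_packing_net K eps (N : nat) :
  (forall k f, packing K eps k f -> (k <= N)%N) ->
  exists k f, packing K eps k f /\ covering_number K eps <= k%:R%:E.
Proof.
move=> bdd.
have ex0 : exists k, `[< exists f, packing K eps k f >].
  exists 0%N; apply/asboolP; exists (fun=> 0%R); split; by case.
have ub k : `[< exists f, packing K eps k f >] -> (k <= N)%N.
  by move=> /asboolP[f]; exact: bdd.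
case: (ex_maxnP ex0 ub) => k /asboolP[f Kf] kmax; exists k, f; split => //.
pose S := [fset f i | i in 'I_k]%fset.
apply: (@le_trans _ _ (#|` S|%:R)%:E); last first.
  rewrite lee_fin ler_nat.
  by rewrite (leq_trans (leq_imfset_card _ _ _))//= size_enum_ord.
apply: ereal_inf_lbound; exists S => //; split.
  by move=> _ /imfsetP[i _ ->]; exact: Kf.1.
move=> x Kx; apply: contrapT => far.
have farf i : (eps <= l2norm (f i - x))%R.
  rewrite leNgt; apply/negP => fx; apply: far; exists (f i).
    by apply/imfsetP; exists i.
  by rewrite l2normC.
have : `[< exists g, packing K eps k.+1 g >].
  apply/asboolP; exists (fun i => oapp f x (unlift ord0 i)); split => [i|i j].
    by case: unliftP => [j _|_] //=; exact: Kf.1.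
  case: unliftP => [i' ->|->]; case: unliftP => [j' ->|->] //=.
  - by rewrite (inj_eq lift_inj); exact: Kf.2.
  - by rewrite l2normC.
by move=> /kmax; rewrite ltnn.
Qed.

Lemma sudakov_le_packing K (B : R) : (0 <= B)%R ->
  (forall eps k f, (0 < eps)%R -> packing K eps k f ->
     (eps ^+ 2 * ln k%:R <= B)%R) ->
  sudakov K <= (Num.sqrt B)%:E.
Proof.
move=> B0 packB; apply: ge_ereal_sup => _ [eps /= eps0 <-].
have [|k [f [Kf cov]]] :=
    maximal_packing_net K eps (Num.Def.archi_bound (expR (B / eps ^+ 2))).
  move=> [//|k] f Kf; rewrite -(ler_nat R); apply: ltW.
  apply: le_lt_trans (archi_boundP (expR_ge0 _)).
  rewrite -[leLHS]lnK ?posrE ?ltr0n// ler_expR ler_pdivlMr ?exprn_gt0//.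
  by rewrite mulrC; exact: packB Kf.
have c0 : 0 <= covering_number K eps.
  by apply: le_ereal_inf_tmp => _ [S _ <-]; rewrite lee_fin.
case: k => [|k] in f Kf cov *.
  rewrite le0_lneNy// mule0 lee_fin; exact: sqrtr_ge0.
have lnk : lne (covering_number K eps) <= (ln k.+1%:R)%:E.
  rewrite -lne_EFin ?ltr0n//.
  by rewrite lee_lne// in_itv/= leey andbT ?lee_fin.
apply: (@le_trans _ _ (eps%:E * sqrte (ln k.+1%:R)%:E)).
  apply: lee_wpmul2l; first by rewrite lee_fin ltW.
  by rewrite lee_sqrt// lee_fin ln_ge0// ler1n.
rewrite /= -EFinM lee_fin -[X in (X * _)%R](gtr0_norm eps0) -sqrtr_sqr.
rewrite -sqrtrM ?sqr_ge0//.
by rewrite ler_wsqrtr//; exact: packB Kf.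
Qed.

End packing.

Lemma sudakov_ge0 {R : realType} p (K : set 'cV[R]_p) : 0 <= sudakov K.
Proof.
apply: (@le_trans _ _ (1%:E * sqrte (lne (covering_number K 1)))).
  by rewrite mul1e sqrte_ge0.
by apply: ereal_sup_ubound; exists 1%R => //=; exact: ltr01.
Qed.

Lemma sume_const_seq {R : realType} I (s : seq I) (c : \bar R) : 0 <= c ->
  \sum_(i <- s) c = (size s)%:R%:E * c.
Proof.
move=> c0; elim: s => [|i s IH]; first by rewrite big_nil mul0e.
by rewrite big_cons IH /= mulrS EFinD ge0_muleDl// ?mul1e// lee_fin.
Qed.

Section volume_ratio.
Context {R : realType} {p : nat}.
Local Notation leb := (borel_copy (@lebesgue_measure R)).
Local Notation ball1 := (@unit_ball R p).

Lemma volume_ge0 (A : set 'cV[R]_p) : 0 <= volume A.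
Proof. exact: (mpow_ge0 leb). Qed.

Lemma le_volume (A B : set 'cV[R]_p) : A `<=` B -> volume A <= volume B.
Proof. exact: (le_mpow leb). Qed.

Lemma volume_bigsetU_le (I : Type) (s : seq I) (A : I -> set 'cV[R]_p) :
  (forall i, measurable (A i)) ->
  volume (\big[setU/set0]_(i <- s) A i) <= \sum_(i <- s) volume (A i).
Proof.
move=> mA; have [m mE] := mpow_measure leb p.
rewrite (_ : @volume R p = m); last exact: mE.
elim: s => [|i s IH]; first by rewrite !big_nil measure0.
rewrite !big_cons; apply: le_trans (leeD2l _ IH).
by apply: measureU2 => //; exact: bigsetU_measurable.
Qed.

Lemma measurable_unit_ball : measurable ball1.
Proof.
rewrite (_ : ball1 = (fun x => sqnorm (x - 0)%R) @^-1` `]-oo, 1%R]).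
  by rewrite -[_ @^-1` _]setTI; apply: measurable_sqnorm.
have normE x : (l2norm x <= 1)%R = (sqnorm (x - 0) <= 1)%R.
  by rewrite subr0 -sqr_l2norm expr_le1// l2norm_ge0.
by apply/seteqP; split=> x; rewrite /unit_ball /= in_itv/= normE.
Qed.

Lemma volume_covering (K : set 'cV[R]_p) (S : {fset 'cV[R]_p}) (eps : R) :
  (0 < eps)%R ->
  (forall x, K x -> exists2 y, y \in S & (l2norm (x - y) < eps)%R) ->
  volume K <= (#|` S|%:R * eps ^+ p)%:E * volume ball1.
Proof.
move=> eps0 KS.
pose A (y : 'cV[R]_p) := [set x | ball1 (- (eps^-1 *: y) + eps^-1 *: x)%R].
have ei0 : (0 < eps^-1)%R by rewrite invr_gt0.
have mA y : measurable (A y).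
  rewrite /A -[[set _ | _]]setTI.
  have mf : measurable_fun setT
      (fun x : 'cV[R]_p => - (eps^-1 *: y) + eps^-1 *: x)%R.
    apply: measurable_fun_mx => i j.
    rewrite (_ : (fun _ => _) =
      (fun x : 'cV[R]_p => - (eps^-1 * y i j) + eps^-1 * x i j)%R).
      apply: measurable_funD => //; apply: measurable_funM => //.
      exact: measurable_mx_entry.
    by apply/funext => x; rewrite !mxE.
  exact: mf measurable_unit_ball.
apply: (@le_trans _ _ (volume (\big[setU/set0]_(y <- S) A y))).
  apply: le_volume => x /KS[y yS xy]; rewrite -bigcup_seq; exists y => //.
  rewrite /A /unit_ball /= addrC -scalerBr l2normZ gtr0_norm//.
  by rewrite ler_pdivrMl// mulr1 ltW.
apply: le_trans (volume_bigsetU_le _ _ _ mA) _.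
rewrite (eq_bigr (fun=> (eps ^+ p)%:E * volume ball1)); last first.
  by move=> y _; rewrite volume_affine ?invrK//; exact: measurable_unit_ball.
rewrite sume_const_seq ?EFinM ?muleA//.
by rewrite mule_ge0 ?volume_ge0// lee_fin exprn_ge0 ?ltW.
Qed.

Lemma volume_ratio_le_sudakov (K : set 'cV[R]_p) : (0 < p)%N ->
  K `<=` ball1 -> volume_ratio K <= (expR 1)%:E * sudakov K.
Proof.
move=> p0 KB.
have eS0 : 0 <= (expR 1)%:E * sudakov K.
  by rewrite mule_ge0 ?sudakov_ge0// lee_fin expR_ge0.
have pV0 : ((p%:R^-1 : R) != 0)%R by rewrite invr_eq0 pnatr_eq0 -lt0n.
have degenerate : volume K / volume ball1 = 0 ->
    volume_ratio K <= (expR 1)%:E * sudakov K.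
  by move=> H; rewrite /volume_ratio H poweR0r// mule0.
have := le_volume _ _ KB; have := volume_ge0 K.
have : forall (S : {fset 'cV[R]_p}) (eps : R), (0 < eps)%R ->
  (forall x, K x -> exists2 y, y \in S & (l2norm (x - y) < eps)%R) ->
  volume K <= (#|` S|%:R * eps ^+ p)%:E * volume ball1.
  exact: volume_covering.
move: degenerate; rewrite /volume_ratio.
case: (volume ball1) => [b||]; last 2 first.
- by rewrite invey mule0 => ->.
- by case: (volume K).
case: (volume K) => [a||]//.
have [->|b0] := eqVneq b 0%R.
  move=> degenerate _; rewrite !lee_fin => a0 a0'; apply: degenerate.
  by rewrite (_ : a = 0%R) ?mul0e//; apply/eqP; rewrite eq_le a0 a0'.
rewrite inver (negbTE b0) -EFinM.
have [->|a0] := eqVneq a 0%R.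
  by rewrite mul0r => ->.
move=> _ cover; rewrite !lee_fin => age0 ab.
have {a0 age0}a0 : (0 < a)%R by rewrite lt_neqAle eq_sym a0.
have {b0}b0 : (0 < b)%R by exact: lt_le_trans ab.
pose kappa := ((a / b) `^ p%:R^-1)%R.
have kappa0 : (0 < kappa)%R by rewrite powR_gt0// divr_gt0.
have kappap : (kappa ^+ p = a / b)%R.
  rewrite -powR_mulrn ?ltW// -powRrM mulVf ?powRr1 ?divr_ge0 ?ltW//.
  by rewrite pnatr_eq0 -lt0n.
pose eps := (kappa / expR 1)%R.
have eps0 : (0 < eps)%R by rewrite divr_gt0// expR_gt0.
have ep0 : (0 < expR 1 ^+ p :> R)%R by rewrite exprn_gt0 ?expR_gt0.
have cov : (expR 1 ^+ p)%:E <= covering_number K eps.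
  apply: le_ereal_inf_tmp => _ [S [_ SK] <-].
  have := cover S eps eps0 SK.
  rewrite -EFinM !lee_fin /eps expr_div_n kappap.
  rewrite (_ : _ * _ * b = a * (#|` S|%:R / expR 1 ^+ p))%R; last first.
    by field; rewrite !gt_eqF.
  by rewrite -{1}(mulr1 a) ler_pM2l// ler_pdivlMr ?exprn_gt0 ?expR_gt0// mul1r.
have lnp : p%:R%:E <= lne (covering_number K eps).
  rewrite -[p%:R%R in leLHS]expRK -[p%:R%R in leLHS]mulr1 expRM_natl.
  rewrite -lne_EFin//.
  have eN0 : 0 <= (expR 1 ^+ p : R)%:E by rewrite lee_fin ltW.
  by rewrite lee_lne// in_itv/= leey andbT//; exact: le_trans cov.
apply: (@le_trans _ _ ((expR 1)%:E * (eps%:E * (Num.sqrt p%:R)%:E))).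
  rewrite poweR_EFin -/kappa -!EFinM lee_fin /eps le_eqVlt.
  apply/orP; left; apply/eqP.
  by field; rewrite gt_eqF ?expR_gt0.
apply: lee_wpmul2l; first by rewrite lee_fin expR_ge0.
apply: (@le_trans _ _ (eps%:E * sqrte (lne (covering_number K eps)))).
  apply: lee_wpmul2l; first by rewrite lee_fin ltW.
  rewrite -[X in X <= _]/(sqrte p%:R%:E) lee_sqrt//.
  by apply: le_trans lnp; rewrite lee_fin.
by apply: ereal_sup_ubound; exists eps.
Qed.

End volume_ratio.

(** * The minimax bound *)

Section sudakov_risk.
Context {R : realType} {d} {Omega : measurableType d} (P : probability Omega R).
Context {p n : nat} (X : 'M[R]_(n, p)) (Z : {RV P >-> 'cV[R]_n}) (s : R).
Hypothesis s0 : (0 < s)%R.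
Hypothesis Z_law : forall A : set 'cV[R]_n, measurable A ->
  distribution P Z A = isotropic_gaussian s A.
Context (T : set 'cV[R]_p).
Hypothesis T_cone : forall (t : R) x, (0 <= t)%R -> T x -> T (t *: x)%R.
Let K := @unit_ball R p `&` T.
Context (psi : R).
Hypothesis X_psi : forall v, K v -> (l2norm (X *m v) <= psi)%R.
Context (Mhat : 'M[R]_(n, p) * 'cV[R]_n -> 'cV[R]_p) (r : R).
Hypothesis mMhat : measurable_fun setT Mhat.
Hypothesis risk_r : forall M, T M ->
  'E_P[fun w => (l2norm (Mhat (X, X *m M + Z w) - M) ^+ 2)%R] <= r%:E.

Lemma packing_risk eps t k (f : 'I_k -> 'cV[R]_p) :
  (0 < eps)%R -> (0 <= t)%R -> packing K eps k f -> (1 < k)%N ->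
  (t ^+ 2 * psi ^+ 2 / s ^+ 2 <= ln k%:R / 2)%R ->
  (t ^+ 2 * eps ^+ 2 / 32 <= r)%R.
Proof.
move=> eps0 t0 [Kf sepf] k1 tk.
have k0 : (0 < k%:R :> R)%R by rewrite ltr0n ltnW.
pose q : R := expR (ln k%:R / 4).
have q0 : (0 < q)%R by exact: expR_gt0.
have qk : (k%:R = q ^+ 4)%R.
  by rewrite /q -expRM_natr divfK// lnK.
have q78 : (q^-1 <= 7 / 8)%R.
  have k2 : (2 <= k%:R :> R)%R by rewrite ler_nat.
  have q87 : (8 / 7 <= q)%R.
    rewrite leNgt; apply/negP => qlt.
    have : (q ^+ 4 < (8 / 7) ^+ 4)%R by rewrite ltr_pXn2r// nnegrE ltW.
    rewrite -qk => H; have : (2 < (8 / 7) ^+ 4 :> R)%R by exact: le_lt_trans H.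
    by rewrite -subr_gt0; apply/negP; rewrite -leNgt; lra.
  by rewrite -[(7 / 8)%R]invrK lef_pV2 ?posrE ?invr_gt0 ?divr_gt0// invf_div.
have H : (t ^+ 2 * eps ^+ 2 / 4 * (1 - q^-1) <= r)%R.
  apply: (risk_ge P X Z s s0 Z_law Mhat k (fun i => t *: f i)%R) => //.
  - by move=> i; apply: risk_r; apply: T_cone => //; exact: (Kf i).2.
  - by rewrite mulr_ge0 ?sqr_ge0.
  - move=> i j ij; rewrite -scalerBr sqnormZ ler_wpM2l ?sqr_ge0//.
    rewrite -sqr_l2norm ler_sqr ?nnegrE ?l2norm_ge0 ?(ltW eps0)//.
    exact: sepf.
  - move=> i; rewrite -scalemxAr sqnormZ.
    rewrite /q -expRM_natr ler_expR.
    rewrite (_ : ln k%:R / 4 * 2 = ln k%:R / 2)%R; last by field.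
    apply: le_trans tk; rewrite ler_wpM2r ?invr_ge0 ?sqr_ge0//.
    rewrite ler_wpM2l ?sqr_ge0// -sqr_l2norm.
    have := X_psi _ (Kf i) => Xi.
    by rewrite ler_sqr ?nnegrE ?l2norm_ge0 ?(le_trans _ Xi)// l2norm_ge0.
apply: le_trans H.
rewrite (_ : _ / 32 = t ^+ 2 * eps ^+ 2 / 4 * (1 - 7 / 8))%R; last by field.
apply: ler_wpM2l; first by rewrite divr_ge0 ?mulr_ge0 ?(ltW eps0).
by rewrite lerD2l lerN2.
Qed.

Lemma sudakov_le_risk : T 0%R -> (0 < psi)%R ->
  sudakov K <= (Num.sqrt (64 * psi ^+ 2 * r / s ^+ 2))%:E.
Proof.
move=> T0 psi0.
have r0 : (0 <= r)%R.
  rewrite -lee_fin; apply: le_trans (risk_r _ T0).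
  by apply: expectation_ge0 => w; exact: sqr_ge0.
apply: sudakov_le_packing.
  by rewrite divr_ge0 ?mulr_ge0 ?sqr_ge0 ?(ltW s0) ?(ltW psi0).
move=> eps [|[|k]] f eps0 Kf.
- by rewrite ln0// mulr0 divr_ge0 ?mulr_ge0 ?sqr_ge0 ?(ltW s0) ?(ltW psi0).
- by rewrite ln1 mulr0 divr_ge0 ?mulr_ge0 ?sqr_ge0 ?(ltW s0) ?(ltW psi0).
have l0 : (0 <= ln k.+2%:R :> R)%R by rewrite ln_ge0// ler1n.
pose u : R := (s ^+ 2 * ln k.+2%:R / (2 * psi ^+ 2))%R.
have u0 : (0 <= u)%R.
  by rewrite divr_ge0 ?mulr_ge0 ?(ltW s0) ?(ltW psi0).
have := packing_risk eps (Num.sqrt u) k.+2 f eps0 (sqrtr_ge0 _) Kf erefl.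
rewrite sqr_sqrtr// => H.
have {}H : (u * eps ^+ 2 / 32 <= r)%R.
  apply: H; rewrite /u le_eqVlt; apply/orP; left; apply/eqP.
  by field; rewrite !gt_eqF.
rewrite ler_pdivlMr ?exprn_gt0//.
rewrite (_ : _ * s ^+ 2 = 64 * psi ^+ 2 * (u * eps ^+ 2 / 32))%R.
  by rewrite ler_wpM2l// mulr_ge0 ?sqr_ge0.
by rewrite /u; field; rewrite gt_eqF.
Qed.

Lemma sudakov_unidentified : psi = 0%R -> sudakov K <= 0.
Proof.
move=> psi0; rewrite -[leRHS]/(0%R%:E) -(sqrtr0 R).
apply: sudakov_le_packing => //.
move=> eps [|[|k]] f eps0 Kf; first by rewrite ln0// mulr0.
  by rewrite ln1 mulr0.
have l0 : (0 <= ln k.+2%:R :> R)%R by rewrite ln_ge0// ler1n.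
have H t : (0 <= t)%R -> (t ^+ 2 * eps ^+ 2 / 32 <= r)%R.
  move=> t0; apply: (packing_risk _ _ _ f) => //.
  by rewrite psi0 expr0n mulr0 mul0r divr_ge0.
have r0 : (0 <= r)%R by have := H 0%R (lexx _); rewrite expr0n !mul0r.
have := H (Num.sqrt (32 * (r + 1) / eps ^+ 2)) (sqrtr_ge0 _).
rewrite sqr_sqrtr ?divr_ge0 ?mulr_ge0 ?addr_ge0 ?sqr_ge0 ?(ltW eps0)//.
rewrite (_ : _ / 32 = r + 1)%R; last by field; rewrite gt_eqF.
by rewrite gerDl ler10.
Qed.

End sudakov_risk.

Theorem theorem6 (R : realType) :
  exists c0 : R, (0 < c0)%R /\
  forall (p n : nat) (T : set 'cV[R]_p) (X : 'M[R]_(n, p)) (sigma : R)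
    (d : measure_display) (Omega : measurableType d) (P : probability Omega R)
    (Z : {RV P >-> 'cV[R]_n}),
  (0 < p)%N -> (0 < n)%N -> (0 < sigma)%R ->
  closed_convex_cone T ->
  (forall A : set 'cV[R]_n, measurable A ->
     distribution P Z A
       = isotropic_gaussian (Num.sqrt (sigma ^+ 2 / n%:R))%R A) ->
  let K := @unit_ball R p `&` T in
  let psi := image_radius X K in
  (c0 * sigma ^+ 2)%:E / psi ^+ 2 *
    maxe (sudakov K / (Num.sqrt n%:R)%:E)
         (volume_ratio K / (Num.sqrt n%:R)%:E) ^+ 2
  <= minimax_risk P X Z T.
Proof.
exists ((64 * expR 1 ^+ 2)^-1)%R; split.
  by rewrite invr_gt0 mulr_gt0// exprn_gt0// expR_gt0.
move=> p n T X sigma d Omega P Z p0 n0 sigma0 [Tne _ _ T_cone] Z_law.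
lazy zeta; set K := _ `&` T; set psi := image_radius X K.
have T0 : T 0%R.
  by have [x Tx] := Tne; have := T_cone 0%R x (lexx _) Tx; rewrite scale0r.
have nR0 : (0 < n%:R :> R)%R by rewrite ltr0n.
set s := Num.sqrt (sigma ^+ 2 / n%:R) in Z_law.
have s0 : (0 < s)%R by rewrite sqrtr_gt0 divr_gt0// exprn_gt0.
have s2 : (s ^+ 2 = sigma ^+ 2 / n%:R)%R.
  by rewrite sqr_sqrtr// divr_ge0 ?sqr_ge0.
have E0 (Mhat : 'M[R]_(n, p) * 'cV[R]_n -> 'cV[R]_p) M :
    0 <= 'E_P[fun w => (l2norm (Mhat (X, X *m M + Z w) - M) ^+ 2)%R].
  by apply: expectation_ge0 => w; exact: sqr_ge0.
apply: le_ereal_inf_tmp => _ [Mhat mMhat <-].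
set risk := ereal_sup _.
have risk_ub M : T M ->
    'E_P[fun w => (l2norm (Mhat (X, X *m M + Z w) - M) ^+ 2)%R] <= risk.
  by move=> TM; apply: ereal_sup_ubound; exists M.
have risk0 : 0 <= risk by apply: le_trans (risk_ub _ T0).
have psi_ub v : K v -> (l2norm (X *m v)%R)%:E <= psi.
  by move=> Kv; apply: ereal_sup_ubound; exists v.
have K0 : K 0%R by split => //; rewrite /unit_ball /= l2norm0.
have psi0 : 0 <= psi.
  by apply: le_trans (psi_ub _ K0); rewrite lee_fin l2norm_ge0.
have SV := volume_ratio_le_sudakov K p0 (@subIsetl _ _ _).
have S0 := sudakov_ge0 _ K.
have sn0 : (0 < Num.sqrt n%:R :> R)%R by rewrite sqrtr_gt0.
set m := maxe _ _.
have m0 : 0 <= m.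
  by rewrite le_max; apply/orP; left; rewrite mule_ge0// inve_ge0 lee_fin ltW.
have mS : m <= (expR 1 / Num.sqrt n%:R)%:E * sudakov K.
  have e1 : (1 <= expR 1 :> R)%R by rewrite -[leLHS]expR0 ler_expR.
  have sni : 0 <= ((Num.sqrt n%:R)^-1 : R)%:E by rewrite lee_fin invr_ge0 ltW.
  rewrite /m inver gt_eqF// ge_max EFinM -muleA (muleC _ (sudakov K)) muleA.
  apply/andP; split; apply: lee_wpmul2r => //.
  by rewrite -[leLHS]mul1e lee_wpmul2r// lee_fin.
case: risk risk0 risk_ub => [r||//] r0 risk_ub; last by rewrite leey.
case: psi psi0 psi_ub => [psi||//] psi0 psi_ub; last first.
  by rewrite [_ ^-1](_ : _ = 0) ?mule0 ?mul0e// invey.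
have X_psi v : K v -> (l2norm (X *m v) <= psi)%R.
  by move=> Kv; rewrite -lee_fin; exact: psi_ub.
rewrite !lee_fin in r0 psi0.
have [psiE|psiN0] := eqVneq psi 0%R.
  have Sle := sudakov_unidentified P X Z s s0 Z_law T T_cone psi X_psi Mhat r
    mMhat risk_ub psiE.
  have SE : sudakov K = 0 by apply/eqP; rewrite eq_le S0 Sle.
  have -> : m = 0 by apply/eqP; rewrite eq_le m0 andbT (le_trans mS)// SE mule0.
  by rewrite -[X in _ * X]/(0 * 0) mul0e mule0 lee_fin.
have psi1 : (0 < psi)%R by rewrite lt_neqAle eq_sym psiN0.
have Sle := sudakov_le_risk P X Z s s0 Z_law T T_cone psi X_psi Mhat r mMhat
    risk_ub T0 psi1.
set B := (64 * psi ^+ 2 * r / s ^+ 2)%R in Sle.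
have B0 : (0 <= B)%R by rewrite divr_ge0 ?mulr_ge0 ?sqr_ge0 ?(ltW s0).
have mB : m <= (expR 1 / Num.sqrt n%:R * Num.sqrt B)%:E.
  by apply: le_trans mS _; rewrite (EFinM _ (Num.sqrt B)); apply: lee_wpmul2l.
have psi2 : psi%:E ^+ 2 = (psi ^+ 2)%:E by rewrite EFin_expe.
rewrite psi2 inver gt_eqF ?exprn_gt0// -EFinM.
set b := (expR 1 / Num.sqrt n%:R * Num.sqrt B)%R in mB.
apply: (@le_trans _ _ (((64 * expR 1 ^+ 2)^-1 * sigma ^+ 2 / psi ^+ 2)%:E *
   (b%:E * b%:E))).
  apply: lee_wpmul2l.
    rewrite lee_fin; apply: divr_ge0; last exact: sqr_ge0.
    by rewrite mulr_ge0 ?invr_ge0 ?mulr_ge0 ?(ltW sigma0) ?expR_ge0.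
  by rewrite expe2; exact: lee_pmul.
rewrite -!EFinM lee_fin -!expr2 /b !exprMn exprVn !sqr_sqrtr ?(ltW nR0)// /B s2.
rewrite le_eqVlt; apply/orP; left; apply/eqP.
by field; rewrite !gt_eqF ?expR_gt0.
Qed.
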